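(* Let $t\ge 0$ be an integer and let $I$ be a monomial ideal. Then $I$ is a $t$-spread strongly stable ideal if and only if $I^{\sigma}$ is a $(t+1)$-spread strongly stable ideal.
   Context: $K$ is a field; $I$ is an ideal of a polynomial ring $K[x_1,\dots,x_n]$. For an integer $s\ge 0$, a monomial $x_{i_1}x_{i_2}\cdots x_{i_d}$ with $i_1\le i_2\le\cdots\le i_d$ is called $s$-spread if $i_j-i_{j-1}\ge s$ for $2\le j\le d$. An $s$-spread monomial ideal is an ideal generated by $s$-spread monomials. For a monomial $u$, $\operatorname{supp}(u)=\{j : x_j \text{ divides } u\}$. An $s$-spread monomial ideal $J$ is called $s$-spread strongly stable if for all $s$-spread monomials $u\in J$, all $j\in\operatorname{supp}(u)$ and all $i<j$ such that $x_i(u/x_j)$ is $s$-spread, one has $x_i(u/x_j)\in J$. $G(I)$ denotes the unique minimal set of monomial generators of a monomial ideal $I$. For $u=x_{i_1}\cdots x_{i_d}$ with $i_1\le\cdots\le i_d$ put $\sigma(u)=\prod_{j=1}^d x_{i_j+(j-1)}$; $I^{\sigma}$ is the ideal generated by the monomials $\sigma(u)$ with $u\in G(I)$, in a polynomial ring $K[x_1,\dots,x_N]$ with $N$ large enough to contain these monomials.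
   Formalization: I is assumed to be a t-spread monomial ideal, not an arbitrary monomial ideal; without this the ''if'' direction fails: for t=1 and I=(x_1x_2, x_1^3), I^σ=(x_1x_3) is 2-spread strongly stable but I is not 1-spread. *)

(* Defs.v *)
From mathcomp Require Import all_boot all_algebra.
From mathcomp Require Export mpoly.

Set Implicit Arguments.
Unset Strict Implicit.
Unset Printing Implicit Defensive.

Import GRing.Theory.
Local Open Scope ring_scope.

(* Ideals are Prop-valued: [idealr_closed] of ring_quotient concerns decidable
   proper ideals only, whereas a monomial ideal may be the whole ring. *)
Definition eq_ideal n (K : fieldType) (I J : {mpoly K[n]} -> Prop) : Prop :=
  forall p, I p <-> J p.

Definition ideal_gen n (K : fieldType) (G : {mpoly K[n]} -> Prop)
    (p : {mpoly K[n]}) : Prop :=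
  exists2 s : seq ({mpoly K[n]} * {mpoly K[n]}),
    (forall x, x \in s -> G x.2) & p = \sum_(x <- s) x.1 * x.2.

(* A monomial u is represented by its exponent vector u : 'X_{1..n}. *)
Definition mon_ideal n (K : fieldType) (G : 'X_{1..n} -> Prop) :
    {mpoly K[n]} -> Prop :=
  ideal_gen (fun p => exists2 u, G u & p = 'X_[u]).

(* [m2s u] is the nondecreasing sequence i_1 <= ... <= i_d with
   u = x_{i_1} ... x_{i_d}; variables are numbered from 0. *)
Definition spread n (s : nat) (u : 'X_{1..n}) : bool :=
  sorted (fun i j : 'I_n => (i + s <= j)%N) (m2s u).

Definition spread_ideal n (K : fieldType) (s : nat)
    (J : {mpoly K[n]} -> Prop) : Prop :=
  exists2 G : 'X_{1..n} -> Prop,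
    (forall u, G u -> spread s u) & eq_ideal J (mon_ideal G).

Definition strongly_stable n (K : fieldType) (s : nat)
    (J : {mpoly K[n]} -> Prop) : Prop :=
  spread_ideal s J /\
  forall u : 'X_{1..n}, spread s u -> J 'X_[u] ->
  forall i j : 'I_n, (0 < u j)%N -> (i < j)%N ->
    spread s (U_(i) + (u - U_(j)))%MM -> J 'X_[(U_(i) + (u - U_(j)))%MM].

Definition min_mon_gens n (K : fieldType) (I : {mpoly K[n]} -> Prop)
    (G : 'X_{1..n} -> Prop) : Prop :=
  eq_ideal I (mon_ideal G) /\
  forall G' : 'X_{1..n} -> Prop, (forall u, G' u -> G u) ->
    eq_ideal I (mon_ideal G') -> forall u, G u -> G' u.

(* u \in G(I) *)
Definition in_G n (K : fieldType) (I : {mpoly K[n]} -> Prop)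
    (u : 'X_{1..n}) : Prop :=
  exists2 G, min_mon_gens I G & G u.

(* The indices i_j + (j - 1), 1 <= j <= d, of the variables in sigma(u). *)
Definition sigma_idx n (u : 'X_{1..n}) : seq nat :=
  [seq (nat_of_ord p.1 + p.2)%N | p <- zip (m2s u) (iota 0 (mdeg u))].

(* sigma(u) as a monomial in N variables; this is the intended monomial only
   if N bounds all the indices in [sigma_idx u]. *)
Definition sigma n (N : nat) (u : 'X_{1..n}) : 'X_{1..N} :=
  [multinom count_mem (nat_of_ord k) (sigma_idx u) | k < N].

Definition sigma_fits n (K : fieldType) (N : nat)
    (I : {mpoly K[n]} -> Prop) : Prop :=
  forall u, in_G I u -> all (fun k => k < N)%N (sigma_idx u).

(* I^sigma depends only on the ideal generated by the sigma(u), which forgets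
   generators sigma(u) that become redundant.  Hence properties of I^sigma do
   not imply that I is a t-spread ideal when t > 0: for t = 1 and
   I = (x_1 x_2, x_1^3) one gets I^sigma = (x_1 x_3, x_1 x_2 x_3) = (x_1 x_3),
   which is 2-spread strongly stable.  So "I is t-spread strongly stable iff
   I^sigma is (t+1)-spread strongly stable" needs I to be t-spread a priori. *)
Definition sigma_ideal n (K : fieldType) (N : nat)
    (I : {mpoly K[n]} -> Prop) : {mpoly K[N]} -> Prop :=
  mon_ideal (fun v => exists2 u, in_G I u & v = sigma N u).
Arguments sigma_ideal [n K] N I.

(* Main.v *)
Require Import Defs.
From mathcomp Require Import all_boot all_algebra.
From mathcomp Require Import zify.
From Stdlib Require Import Classical.

(** Write a monomial as the sorted sequence of its indices, and say that [b]
    dominates [a] when [b] is at least as long as [a] and entrywise at most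
    [a] on the first [size a] entries.  Multiples of a monomial and its images
    under the moves [u -> x_i (u / x_j)] all dominate it; conversely an
    [s]-spread strongly stable ideal is closed under passing to [s]-spread
    monomials that dominate a given [s]-spread member.  Consequently every
    [s]-spread monomial of such an ideal has a prefix which is one of any
    prescribed [s]-spread generators.  As [sigma] commutes with prefixes and
    respects domination in both directions, both implications follow by
    carrying a prefix through [sigma] and extracting a generator from it. *)

Set Implicit Arguments.
Unset Strict Implicit.
Unset Printing Implicit Defensive.

Import GRing.Theory.

(** * Spread sequences, domination and the index shift *)

Definition seq_spread (s : nat) (l : seq nat) : bool :=
  sorted (fun i j => i + s <= j) l.

Definition dominates (s t : seq nat) : Prop :=
  forall i, i < size s -> (i < size t) && (nth 0 t i <= nth 0 s i).

(** The effect of [sigma] on index sequences: positions count from 0, so adding [i] is adding j - 1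
    to the j-th index. *)
Definition shift (l : seq nat) : seq nat :=
  mkseq (fun i => nth 0 l i + i) (size l).

(** Subtraction is truncated; it is exact on [s.+1]-spread sequences, whose entry at position [i] is
    at least [i]. *)
Definition unshift (l : seq nat) : seq nat :=
  mkseq (fun i => nth 0 l i - i) (size l).

Lemma seq_spread_sorted s l : seq_spread s l -> sorted leq l.
Proof.
by apply: sub_sorted => i j; apply: leq_trans; rewrite leq_addr.
Qed.

Lemma seq_spreadP s l :
  reflect (forall i, i.+1 < size l -> nth 0 l i + s <= nth 0 l i.+1)
          (seq_spread s l).
Proof. exact: sortedP. Qed.

Lemma seq_spread_take s e l : seq_spread s l -> seq_spread s (take e l).
Proof. exact: take_sorted. Qed.

Lemma dominates_trans s t r : dominates s t -> dominates t r -> dominates s r.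
Proof.
move=> st tr i /st /andP[/tr/andP[-> le_rt] le_ts].
exact: leq_trans le_rt le_ts.
Qed.

Lemma dominates_size s t : dominates s t -> size s <= size t.
Proof.
case: (posnP (size s)) => [-> //|s_gt0 /(_ (size s).-1)].
by rewrite prednK // => /(_ (leqnn _)) /andP[].
Qed.

Lemma dominates_take s t : dominates s t -> dominates s (take (size s) t).
Proof.
move=> st i lt_is; have /andP[lt_it le_ts] := st _ lt_is.
by rewrite size_take_min leq_min lt_is lt_it nth_take.
Qed.

Lemma dominates_all s t n :
  dominates s t -> size t <= size s -> all (fun k => k < n) s ->
  all (fun k => k < n) t.
Proof.
move=> st le_ts /(all_nthP 0) s_lt; apply/(all_nthP 0) => i lt_it.
have lt_is := leq_trans lt_it le_ts; have /andP[_] := st _ lt_is.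
by move=> /leq_ltn_trans; apply; apply: s_lt.
Qed.

(** In a sorted sequence the entries at most [k] form a prefix, and the count is its length. *)
Lemma sorted_lt_count l i k : sorted leq l ->
  (i < count (fun j => j <= k) l) = (i < size l) && (nth 0 l i <= k).
Proof.
move=> l_sorted; apply/idP/andP => [lt_ic|[lt_il le_k]].
  have lt_il : i < size l := leq_trans lt_ic (count_size _ _).
  split=> //; rewrite leqNgt; apply/negP => lt_k.
  move: lt_ic; rewrite -{1}(cat_take_drop i l) count_cat.
  have -> : count (fun j => j <= k) (drop i l) = 0.
    apply/eqP; rewrite -leqn0 leqNgt -has_count -all_predC.
    apply/(all_nthP 0) => j; rewrite size_drop nth_drop /= -ltnNge => lt_j.
    apply: (leq_trans lt_k).
    by apply: (sorted_leq_nth leq_trans leqnn 0 l_sorted);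
      rewrite ?inE; lia.
  rewrite addn0 => /leq_trans/(_ (count_size _ _)).
  by rewrite size_take_min leq_min ltnn.
rewrite -(cat_take_drop i.+1 l) count_cat.
apply: (leq_trans _ (leq_addr _ _)).
have /eqP -> : count (fun j => j <= k) (take i.+1 l) == size (take i.+1 l).
  rewrite -all_count; apply/(all_nthP 0) => j.
  rewrite size_take_min leq_min => /andP[lt_ji lt_jl]; rewrite nth_take //.
  apply: leq_trans le_k.
  by apply: (sorted_leq_nth leq_trans leqnn 0 l_sorted); rewrite ?inE; lia.
by rewrite size_takel.
Qed.

(** Cumulative counts avoid tracking positions: for monomials they are sums of exponents, so
    domination follows by comparing such sums. *)
Lemma dominates_count s t : sorted leq s -> sorted leq t ->
  (forall k, count (fun j => j <= k) s <= count (fun j => j <= k) t) ->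
  dominates s t.
Proof.
move=> s_sorted t_sorted le_count i lt_is.
rewrite -sorted_lt_count //; apply: leq_trans (le_count _).
by rewrite sorted_lt_count // lt_is leqnn.
Qed.

Lemma size_shift l : size (shift l) = size l.
Proof. exact: size_mkseq. Qed.

Lemma size_unshift l : size (unshift l) = size l.
Proof. exact: size_mkseq. Qed.

Lemma nth_shift l i : i < size l -> nth 0 (shift l) i = nth 0 l i + i.
Proof. exact: nth_mkseq. Qed.

Lemma nth_unshift l i : i < size l -> nth 0 (unshift l) i = nth 0 l i - i.
Proof. exact: nth_mkseq. Qed.

Lemma shift_inj : injective shift.
Proof.
move=> a b eq_ab; have eq_size : size a = size b.
  by rewrite -(size_shift a) eq_ab size_shift.
apply: (@eq_from_nth _ 0) => // i lt_i; apply: (@addIn i).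
by rewrite -!nth_shift -?eq_size // eq_ab.
Qed.

Lemma shift_take e l : shift (take e l) = take e (shift l).
Proof.
have eq_size : size (take e l) = size (take e (shift l)).
  by rewrite !size_take_min size_shift.
apply: (@eq_from_nth _ 0); rewrite size_shift // => i lt_i.
rewrite nth_shift //; move: lt_i; rewrite size_take_min leq_min.
by move=> /andP[lt_ie lt_il]; rewrite !nth_take // nth_shift.
Qed.

Lemma spread_ge_index s l i :
  seq_spread s.+1 l -> i < size l -> i <= nth 0 l i.
Proof.
move=> /seq_spreadP l_spread; elim: i => // i IHi lt_i.
have := l_spread _ lt_i; have := IHi (ltnW lt_i); lia.
Qed.

Lemma unshiftK s l : seq_spread s.+1 l -> shift (unshift l) = l.
Proof.
move=> l_spread; apply: (@eq_from_nth _ 0); rewrite size_shift size_unshift //.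
move=> i lt_i; rewrite nth_shift ?size_unshift // nth_unshift // subnK //.
exact: spread_ge_index l_spread lt_i.
Qed.

Lemma seq_spread_shift s l : seq_spread s l -> seq_spread s.+1 (shift l).
Proof.
move=> /seq_spreadP l_spread; apply/seq_spreadP => i; rewrite size_shift => lt_i.
by rewrite !nth_shift ?(ltnW lt_i) //; have := l_spread _ lt_i; lia.
Qed.

Lemma seq_spread_unshift s l : seq_spread s.+1 l -> seq_spread s (unshift l).
Proof.
move=> l_spread; apply/seq_spreadP => i; rewrite size_unshift => lt_i.
rewrite !nth_unshift ?(ltnW lt_i) //.
have := spread_ge_index l_spread (ltnW lt_i).
by have /seq_spreadP/(_ i lt_i) := l_spread; lia.
Qed.

Lemma dominates_shift a b : dominates a b -> dominates (shift a) (shift b).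
Proof.
move=> ab i; rewrite !size_shift => lt_i; have /andP[lt_ib le_ba] := ab _ lt_i.
by rewrite lt_ib !nth_shift // leq_add2r.
Qed.

Lemma dominates_unshift a b :
  dominates (shift a) b -> dominates a (unshift b).
Proof.
move=> ab i lt_i; have := ab i; rewrite size_shift => /(_ lt_i) /andP[lt_ib].
by rewrite size_unshift lt_ib nth_shift // nth_unshift // leq_subLR addnC.
Qed.

(** * Monomials as sorted index sequences *)

Definition idx n (u : 'X_{1..n}) : seq nat := map val (m2s u).

(* Entries [>= n] of [l] are silently dropped. *)
Definition mon n (l : seq nat) : 'X_{1..n} :=
  [multinom count_mem (nat_of_ord k) l | k < n].

Section Monomials.
Variable n : nat.
Implicit Types u v : 'X_{1..n}.

Lemma sorted_idx u : sorted leq (idx u).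
Proof. exact: srt_m2s. Qed.

Lemma size_idx u : size (idx u) = mdeg u.
Proof. by rewrite size_map size_m2s. Qed.

Lemma all_idx u : all (fun k => k < n) (idx u).
Proof. by rewrite all_map; apply/allP => i _ /=. Qed.

Lemma count_idx u (p : pred nat) : count p (idx u) = \sum_(i < n | p i) u i.
Proof.
rewrite /idx /m2s count_map count_flatten sumnE !big_map /=.
rewrite [RHS]big_mkcond; apply: eq_bigr => i _ /=.
by rewrite count_nseq /=; case: (p i); rewrite ?mul1n ?mul0n.
Qed.

Lemma idxK u : mon n (idx u) = u.
Proof.
by apply/mnmP => i; rewrite mnmE count_idx (big_pred1 i).
Qed.

Lemma monK l : sorted leq l -> all (fun k => k < n) l -> idx (mon n l) = l.
Proof.
move=> l_sorted /allP l_lt.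
apply: (sorted_eq leq_trans anti_leq (sorted_idx _) l_sorted).
apply/allP => k; rewrite mem_cat => k_in; apply/eqP.
have lt_kn : k < n.
  by case/orP: k_in => [/(allP (all_idx _))|/l_lt].
rewrite count_idx (big_pred1 (Ordinal lt_kn)); first by rewrite mnmE.
by move=> i; rewrite /= -val_eqE.
Qed.

Lemma mon_cat l1 l2 : mon n (l1 ++ l2) = (mon n l1 + mon n l2)%MM.
Proof. by apply/mnmP => i; rewrite mnmDE !mnmE count_cat. Qed.

Lemma mon_take_le e l : (mon n (take e l) <= mon n l)%MM.
Proof. by rewrite -{2}(cat_take_drop e l) mon_cat lem_addr. Qed.

Lemma mon1 (i : 'I_n) : mon n [:: nat_of_ord i] = U_(i)%MM.
Proof. by apply/mnmP => k; rewrite mnm1E mnmE /= addn0. Qed.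

Lemma spread_idx s u : spread s u = seq_spread s (idx u).
Proof. by rewrite /seq_spread /idx sorted_map. Qed.

Lemma spread_mon s l :
  all (fun k => k < n) l -> seq_spread s l -> spread s (mon n l).
Proof. by move=> l_lt l_s; rewrite spread_idx monK // (seq_spread_sorted l_s). Qed.

Lemma dominates_le u v : (u <= v)%MM -> dominates (idx u) (idx v).
Proof.
move=> /mnm_lepP le_uv; apply: dominates_count; rewrite ?sorted_idx // => k.
by rewrite !count_idx; apply: leq_sum.
Qed.

Lemma sum_mnm1 (i : 'I_n) (p : pred 'I_n) :
  \sum_(k < n | p k) U_(i)%MM k = p i.
Proof.
rewrite big_mkcond (bigD1 i) //= big1 ?addn0; last first.
  by move=> k /negPf ne_ki; rewrite mnm1E eq_sym ne_ki if_same.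
by rewrite mnm1E eqxx; case: (p i).
Qed.

(** With [u = w + U_(j)], the number of indices at most [k] changes by [i <= k] - [j <= k], which is
    nonnegative because [i < j]. *)
Lemma dominates_move u (i j : 'I_n) : 0 < u j -> i < j ->
  dominates (idx u) (idx (U_(i) + (u - U_(j)))%MM).
Proof.
move=> u_j lt_ij; apply: dominates_count; rewrite ?sorted_idx // => k.
rewrite !count_idx; set w := (u - U_(j))%MM.
have -> : u = (w + U_(j))%MM by rewrite submK // lep1mP -lt0n.
under eq_bigr => l _ do rewrite mnmDE.
under [leqRHS]eq_bigr => l _ do rewrite mnmDE.
by rewrite !big_split /= !sum_mnm1; lia.
Qed.

Lemma lem_mdeg_eq u v : (u <= v)%MM -> mdeg v <= mdeg u -> u = v.
Proof.
move=> /submK eq_v; rewrite -eq_v mdegD -{2}[mdeg u]add0n leq_add2r leqn0.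
by rewrite mdeg_eq0 => /eqP ->; rewrite add0m.
Qed.

End Monomials.

(** * Monomial ideals and their minimal generators *)

Section Ideals.
Variables (K : fieldType) (n : nat).
Implicit Types (G H : 'X_{1..n} -> Prop) (I J : {mpoly K[n]} -> Prop).
Local Open Scope ring_scope.

Lemma mon_idealX G u v : G u -> (u <= v)%MM -> mon_ideal (K := K) G 'X_[v].
Proof.
move=> Gu le_uv; exists [:: ('X_[v - u], 'X_[u])].
  by move=> x; rewrite inE => /eqP -> /=; exists u.
by rewrite big_seq1 /= -mpolyXD submK.
Qed.

Lemma mon_idealXP G v :
  mon_ideal (K := K) G 'X_[v] <-> exists2 u, G u & (u <= v)%MM.
Proof.
split=> [[s sG eq_v]|[u Gu le_uv]]; last exact: mon_idealX le_uv.
(* [v] occurs in the combination, hence in a single term [x.1 * 'X_[u]], all of whose monomials are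
   multiples of [u]. *)
have : v \in msupp ('X_[v] : {mpoly K[n]}) by rewrite msuppX inE.
rewrite eq_v => /msupp_sum_le /flatten_mapP[x].
rewrite filter_predT => /sG [u Gu ->] /msuppM_le /allpairsP[[a b] /= [_]].
by rewrite msuppX inE => /eqP -> ->; exists u => //; apply: lem_addl.
Qed.

Lemma mon_ideal_refine G H :
  (forall u, G u -> exists2 v, H v & (v <= u)%MM) ->
  forall p, mon_ideal (K := K) G p -> mon_ideal H p.
Proof.
move=> GH p [s]; elim: s p => [|x s IHs] p sG ->.
  by exists [::]; rewrite ?big_nil.
have [r rH eq_r] := IHs _ (fun y ys => sG y (@mem_behead _ (x :: s) y ys)) erefl.
have [u Gu eq_x] := sG x (mem_head _ _); have [v Hv le_vu] := GH _ Gu.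
exists ((x.1 * 'X_[u - v], 'X_[v]) :: r).
  by move=> y; rewrite inE => /orP[/eqP -> /=|/rH //]; exists v.
by rewrite !big_cons eq_r /= -mulrA -mpolyXD submK // eq_x.
Qed.

(** An intrinsic description of G(I) by divisibility, independent of any generating set. *)
Definition minimal_in I u : Prop :=
  I 'X_[u] /\ forall v, (v <= u)%MM -> I 'X_[v] -> v = u.

(** Induction on the degree: a proper divisor has smaller degree. Membership in [I] is a
    proposition, so the case distinction is classical. *)
Lemma minimal_below I u :
  I 'X_[u] -> exists2 v, minimal_in I v & (v <= u)%MM.
Proof.
elim: {u}(mdeg u).+1 {-2}u (ltnSn (mdeg u)) => // d IHd u le_ud Iu.
case: (classic (minimal_in I u)) => [min_u|not_min].
  by exists u => //; apply: lepm_refl.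
have [v le_vu [Iv ne_vu]] :
    exists2 v, (v <= u)%MM & I 'X_[v] /\ v <> u.
  apply: NNPP => none; apply: not_min; split=> // v le_vu Iv.
  by apply: NNPP => ne_vu; apply: none; exists v.
have [|w min_w le_wv] := IHd v _ Iv; last first.
  by exists w => //; apply: lepm_trans le_vu.
rewrite ltnS in le_ud; apply: leq_trans le_ud.
by rewrite ltnNge; apply/negP => /(lem_mdeg_eq le_vu).
Qed.

Lemma minimal_sub I G u : eq_ideal I (mon_ideal G) -> minimal_in I u -> G u.
Proof.
move=> eqI [/eqI/mon_idealXP[g Gg le_gu] min_u].
by rewrite -(min_u _ le_gu) //; apply/eqI; apply: mon_idealX Gg (lepm_refl _).
Qed.

Lemma minimal_gens I G :
  eq_ideal I (mon_ideal G) -> eq_ideal I (mon_ideal (minimal_in I)).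
Proof.
move=> eqI p; split=> [/eqI|min_p].
  apply: mon_ideal_refine => u Gu; apply: minimal_below.
  by apply/eqI; apply: mon_idealX Gu (lepm_refl _).
apply/eqI; apply: mon_ideal_refine min_p => u /(minimal_sub eqI) Gu.
by exists u => //; apply: lepm_refl.
Qed.

(** The minimal monomials generate [I] and lie in every monomial generating set, so they form the
    only minimal one. *)
Lemma in_G_minimal I G u :
  eq_ideal I (mon_ideal G) -> in_G I u <-> minimal_in I u.
Proof.
move=> eqI; split=> [[G' [eqI' min_G'] G'u]|min_u].
  apply: min_G' G'u => [v min_v|]; last exact: minimal_gens eqI.
  exact: minimal_sub min_v.
exists (minimal_in I) => //; split; first exact: minimal_gens eqI.
by move=> H _ eqIH v; apply: minimal_sub.
Qed.

Lemma in_G_sub I G u : eq_ideal I (mon_ideal G) -> in_G I u -> G u.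
Proof. by move=> eqI /(in_G_minimal _ eqI); apply: minimal_sub. Qed.

Lemma in_G_gens I G :
  eq_ideal I (mon_ideal G) -> eq_ideal I (mon_ideal (in_G I)).
Proof.
move=> eqI p; split=> [/(minimal_gens eqI)|].
  apply: mon_ideal_refine => u /(in_G_minimal _ eqI) Iu.
  by exists u => //; apply: lepm_refl.
move=> Gp; apply/(minimal_gens eqI); apply: mon_ideal_refine Gp => u.
by move=> /(in_G_minimal _ eqI) Iu; exists u => //; apply: lepm_refl.
Qed.

Lemma mon_ideal_up I G u v :
  eq_ideal I (mon_ideal G) -> I 'X_[u] -> (u <= v)%MM -> I 'X_[v].
Proof.
move=> eqI /eqI/mon_idealXP[g Gg le_gu] le_uv.
by apply/eqI; apply: mon_idealX Gg (lepm_trans le_gu le_uv).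
Qed.

(** * Strongly stable ideals and domination *)

Lemma strongly_stable_move s J a b k l :
  strongly_stable s J ->
  seq_spread s (a ++ l :: b) -> seq_spread s (a ++ k :: b) ->
  all (fun i => i < n)%N (a ++ l :: b) -> (k <= l)%N ->
  J 'X_[mon n (a ++ l :: b)] -> J 'X_[mon n (a ++ k :: b)].
Proof.
move=> [_ J_move] spread_l spread_k lt_n; rewrite leq_eqVlt.
case/orP => [/eqP -> // | lt_kl] Jl.
have lt_ln : (l < n)%N.
  by move/allP: lt_n; apply; rewrite mem_cat mem_head orbT.
have lt_kn := ltn_trans lt_kl lt_ln.
pose i := Ordinal lt_kn; pose j := Ordinal lt_ln.
have monE (h : 'I_n) :
    mon n (a ++ nat_of_ord h :: b) = (U_(h) + (mon n (a ++ b)))%MM.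
  by rewrite -cat1s !mon_cat mon1 addmA (addmC (mon n a)) -addmA.
have eq_k : mon n (a ++ k :: b)
    = (U_(i) + (mon n (a ++ l :: b) - U_(j)))%MM.
  rewrite (monE i) (monE j); congr (_ + _)%MM.
  by rewrite addmC addmK.
rewrite eq_k; apply: J_move => //.
- exact: spread_mon.
- by rewrite (monE j) mnmDE mnm1E eqxx.
rewrite -eq_k; apply: spread_mon => //.
move: lt_n; rewrite !all_cat /= lt_ln lt_kn.
by move=> /andP[-> ->].
Qed.

(** The entries of [g] are replaced by those of [z] one at a time from the left, each replacement
    being a stability move or trivial. This puts the prefix of [z] of length [size g] in [J], and
    that prefix divides [z]. *)
Lemma strongly_stable_dominates s J g z :
  strongly_stable s J -> seq_spread s g -> seq_spread s z ->
  all (fun i => i < n)%N g -> dominates g z ->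
  J 'X_[mon n g] -> J 'X_[mon n z].
Proof.
move=> stJ spread_g spread_z lt_g gz Jg.
have le_size := dominates_size gz.
pose mix m := take m z ++ drop m g.
have size_mix m : (m <= size g)%N -> size (mix m) = size g.
  move=> le_m; rewrite size_cat size_takel ?(leq_trans le_m) //.
  by rewrite size_drop subnKC.
have nth_mix m i : (m <= size g)%N ->
    nth 0%N (mix m) i = if (i < m)%N then nth 0%N z i else nth 0%N g i.
  move=> le_m; rewrite nth_cat size_takel ?(leq_trans le_m) //.
  by case: ltnP => [lt_im|le_mi]; rewrite ?nth_take // nth_drop subnKC.
have spread_mix m : (m <= size g)%N -> seq_spread s (mix m).
  move=> le_m; apply/seq_spreadP => i; rewrite size_mix // => lt_i.
  rewrite !nth_mix //.
  have /seq_spreadP/(_ i) := spread_z; have /seq_spreadP/(_ i lt_i) := spread_g.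
  have /andP[_] := gz _ (ltnW lt_i); have /andP[] := gz _ lt_i.
  (* At the junction [i.+1 = m] the left entry comes from [z] and is at most that of [g], so the gap
     can only grow. *)
  case: (ltnP i.+1 m); case: (ltnP i m); lia.
have all_mix m : (m <= size g)%N -> all (fun i => i < n)%N (mix m).
  move=> le_m; apply: dominates_all (lt_g); last by rewrite size_mix.
  move=> i lt_i; rewrite size_mix // lt_i nth_mix //.
  by case: ifP => _ /=; [have /andP[] := gz _ lt_i | apply: leqnn].
have Jmix m : (m <= size g)%N -> J 'X_[mon n (mix m)].
  elim: m => [_|m IHm lt_m]; first by rewrite /mix take0 drop0.
  have mixE : mix m = take m z ++ nth 0%N g m :: drop m.+1 g.
    by rewrite /mix (drop_nth 0%N lt_m).
  have mixSE : mix m.+1 = take m z ++ nth 0%N z m :: drop m.+1 g.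
    by rewrite /mix (take_nth 0%N) ?cat_rcons // (leq_trans lt_m).
  rewrite mixSE; apply: (strongly_stable_move (s := s) (l := nth 0%N g m)) => //.
  - by rewrite -mixE; apply/spread_mix/ltnW.
  - by rewrite -mixSE; apply: spread_mix.
  - by rewrite -mixE; apply/all_mix/ltnW.
  - by have /andP[] := gz _ lt_m.
  by rewrite -mixE; apply/IHm/ltnW.
have [[G _ eqJ] _] := stJ; apply: (mon_ideal_up eqJ) (mon_take_le n (size g) z).
by have := Jmix _ (leqnn _); rewrite /mix drop_size cats0.
Qed.

(** Some [h] in [H] divides [z]. If [z] is no longer than [h], they are equal. Otherwise the prefix
    of [z] of the length of [h] dominates [h], so it lies in [J], and induction on the length
    applies to it. *)
Lemma generator_prefix s J H z :
  strongly_stable s J -> eq_ideal J (mon_ideal H) ->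
  (forall u, H u -> spread s u) ->
  seq_spread s z -> all (fun i => i < n)%N z -> J 'X_[mon n z] ->
  exists e, H (mon n (take e z)).
Proof.
move=> stJ eqJ spread_H.
elim: {z}(size z).+1 {-2}z (ltnSn (size z)) => // d IHd z le_zd.
move=> spread_z lt_z /eqJ/mon_idealXP[h Hh le_hz].
have idx_z := monK (seq_spread_sorted spread_z) lt_z.
have hz := dominates_le le_hz; rewrite idx_z in hz.
case: (leqP (size z) (size (idx h))) => [le_size|lt_size].
  exists (size z); rewrite take_size -(lem_mdeg_eq le_hz) //.
  by rewrite -!size_idx idx_z.
have [||||e He] := IHd (take (size (idx h)) z).
- by rewrite size_takel ?(leq_trans lt_size) // ltnW.
- exact: seq_spread_take.
- by apply/allP => k /mem_take; apply: (allP lt_z).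
- apply: (strongly_stable_dominates stJ _ _ (all_idx h)).
  + by rewrite -spread_idx; apply: spread_H.
  + exact: seq_spread_take.
  + exact: dominates_take.
  by rewrite idxK; apply/eqJ; apply: mon_idealX Hh (lepm_refl _).
by exists (minn e (size (idx h))); rewrite take_min.
Qed.

End Ideals.

(** * The operator sigma and the equivalence *)

Lemma sigma_idxE n (u : 'X_{1..n}) : sigma_idx u = shift (idx u).
Proof.
have zip_size : size (m2s u) = size (iota 0 (mdeg u)).
  by rewrite size_iota size_m2s.
rewrite /sigma_idx; apply: (@eq_from_nth _ 0).
  by rewrite size_map size1_zip ?zip_size // size_shift size_map zip_size.
move=> i; rewrite size_map size1_zip ?zip_size // => lt_i.
have lt_i' : i < size (m2s u) by rewrite zip_size.
have lt_iu : i < mdeg u by rewrite -size_m2s.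
rewrite nth_shift ?size_map // /idx.
(* The head [x0] serves as a default value in ['I_n], which could be empty. *)
case: (m2s u) zip_size lt_i' => // x0 s zip_size lt_i'.
rewrite (nth_map (x0, 0)) ?size1_zip ?zip_size // nth_zip //=.
by rewrite nth_iota // add0n -(nth_map x0 0 val).
Qed.

Theorem proposition1p9 (K : fieldType) (n N t : nat)
    (I : {mpoly K[n]} -> Prop)
    (I_spread : spread_ideal t I) (N_large : sigma_fits N I) :
  strongly_stable t I <-> strongly_stable t.+1 (sigma_ideal N I).
Proof.
have [G G_spread eqIG] := I_spread; have eqI := in_G_gens eqIG.
have gen_spread u : in_G I u -> seq_spread t (idx u).
  by move=> /(in_G_sub eqIG)/G_spread; rewrite spread_idx.
have gen_in u : in_G I u -> I 'X_[u]%R.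
  by move=> Gu; apply/eqI; apply: mon_idealX Gu (lepm_refl _).
have sigmaE u : sigma N u = mon N (shift (idx u)).
  by rewrite -sigma_idxE.
have idx_sigma u : in_G I u -> idx (sigma N u) = shift (idx u).
  move=> Gu; rewrite sigmaE monK //; last by rewrite -sigma_idxE; apply: N_large.
  exact: seq_spread_sorted (seq_spread_shift (gen_spread _ Gu)).
set H := fun v => exists2 u, in_G I u & v = sigma N u.
have eqJ : eq_ideal (sigma_ideal N I) (mon_ideal H) by [].
have H_spread v : H v -> spread t.+1 v.
  move=> [u Gu ->]; rewrite spread_idx idx_sigma //.
  exact: seq_spread_shift (gen_spread _ Gu).
(* Generation by spread monomials comes from [H] on one side and from [I_spread] on the other;
   closure under moves remains in both directions. *)
split=> [stI|stJ]; split; [by exists H | | exact: I_spread | ].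
  move=> u _ Ju i j u_j lt_ij; set v := (U_(i) + _)%MM.
  rewrite spread_idx => v_spread.
  have [w Gw le_wu] : exists2 w, in_G I w & (sigma N w <= u)%MM.
    by have [_ [w Gw ->]] := (mon_idealXP K H u).1 Ju; exists w.
  have dom_w : dominates (idx w) (unshift (idx v)).
    apply: dominates_unshift; rewrite -idx_sigma //.
    exact: dominates_trans (dominates_le le_wu) (dominates_move u_j lt_ij).
  (* Cutting to the length of [w] bounds each entry by one of [w], hence below [n]; later entries
     need not be below [n]. *)
  set z := take (size (idx w)) (unshift (idx v)).
  have z_spread : seq_spread t z.
    exact: seq_spread_take (seq_spread_unshift v_spread).
  have dom_z : dominates (idx w) z := dominates_take dom_w.
  have lt_z : all (fun k => k < n) z.
    apply: dominates_all dom_z _ (all_idx w).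
    by rewrite size_takel // dominates_size.
  have [||e Ge] := generator_prefix stI eqI _ z_spread lt_z.
  - by move=> x Gx; rewrite spread_idx; apply: gen_spread.
  - apply: (strongly_stable_dominates stI (gen_spread _ Gw)) dom_z _ => //.
      exact: all_idx.
    by rewrite idxK; apply: gen_in.
  (* The generator given by [take e z] becomes, after shifting, a prefix of [idx v], so its image
     under [sigma] divides [v]. *)
  apply: (@mon_idealX K N _ (sigma N (mon n (take e z)))).
    by exists (mon n (take e z)).
  rewrite sigmaE monK; last 2 first.
  - exact: seq_spread_sorted (seq_spread_take _ z_spread).
  - by apply/allP => k /mem_take; apply: (allP lt_z).
  rewrite !shift_take (unshiftK v_spread) -[X in (_ <= X)%MM]idxK.
  exact: lepm_trans (mon_take_le _ _ _) (mon_take_le _ _ _).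
move=> u _ Iu i j u_j lt_ij; set v := (U_(i) + _)%MM.
rewrite spread_idx => v_spread.
have [w Gw le_wu] := (mon_idealXP K (in_G I) u).1 ((eqI _).1 Iu).
have dom_w : dominates (idx w) (idx v).
  exact: dominates_trans (dominates_le le_wu) (dominates_move u_j lt_ij).
(* The cut is made before shifting, so that the shifted entries are bounded by those of [sigma N w],
   hence lie below [N]. *)
set z := shift (take (size (idx w)) (idx v)).
have z_spread : seq_spread t.+1 z.
  exact: seq_spread_shift (seq_spread_take _ v_spread).
have dom_z : dominates (idx (sigma N w)) z.
  by rewrite idx_sigma //; apply/dominates_shift/dominates_take.
have lt_z : all (fun k => k < N) z.
  apply: dominates_all dom_z _ (all_idx _).
  by rewrite idx_sigma // !size_shift size_takel // dominates_size.
have [|e [x Gx eq_x]] := generator_prefix stJ eqJ H_spread z_spread lt_z.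
  apply: (strongly_stable_dominates stJ) dom_z _ => //.
  - by rewrite -spread_idx; apply: H_spread; exists w.
  - exact: all_idx.
  by rewrite idxK; apply: mon_idealX (lepm_refl _); exists w.
(* [sigma N x] is a prefix of [z]; injectivity of [shift] turns this into [x] being a prefix of [v],
   hence a divisor. *)
have {eq_x} idx_x : idx x = take e (take (size (idx w)) (idx v)).
  apply: shift_inj; rewrite -idx_sigma // -eq_x monK ?[RHS]shift_take //.
    exact: seq_spread_sorted (seq_spread_take _ z_spread).
  by apply/allP => k /mem_take; apply: (allP lt_z).
apply: (mon_ideal_up eqI (gen_in _ Gx)).
rewrite -[x]idxK idx_x -[X in (_ <= X)%MM]idxK.
exact: lepm_trans (mon_take_le _ _ _) (mon_take_le _ _ _).
Qed.
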